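(* Let $a,b>0$ and $q\in(0,1]$ be constants, let $\mathcal{A}$ be the area function defined in the context, and let $T_n(k)$ and $\mathbb{T}_n^{\beta}(k)$ ($n\in\mathbb{N}_0$) be its first and second Taylor approximations at $0$ as defined in the context. Then for every fixed $\beta\in(0,1)$ and every $k\in(0,\beta]$ $$a\,b\,q\,\pi=T_0(k)=T_1(k)\ge T_2(k)=T_3(k)\ge\cdots\ge T_{2i}(k)=T_{2i+1}(k)\ge\cdots\ge\mathcal{A}(k)$$ and $$\mathcal{A}(k)\ge\cdots\ge\mathbb{T}_j^{\beta}(k)\ge\cdots\ge\mathbb{T}_3^{\beta}(k)\ge\mathbb{T}_2^{\beta}(k)\ge\mathbb{T}_1^{\beta}(k)\ge\mathbb{T}_0^{\beta}(k)=\mathcal{A}(\beta).$$ That is, for all $i,j\in\mathbb{N}_0$: $T_{2i}(k)=T_{2i+1}(k)\ge T_{2i+2}(k)\ge\mathcal{A}(k)\ge\mathbb{T}_{j+1}^{\beta}(k)\ge\mathbb{T}_j^{\beta}(k)$.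
   Context: Here $n!!$ denotes the double factorial and $[\cdot]$ the integer part. Complete elliptic integrals (in terms of the modulus $k$): $K(k)=\int_0^{\pi/2}\frac{d\theta}{\sqrt{1-k^2\sin^2\theta}}$ for $0\le k<1$, $E(k)=\int_0^{\pi/2}\sqrt{1-k^2\sin^2\theta}\,d\theta$ for $0\le k\le1$, and $D(k)=\frac{K(k)-E(k)}{k^2}$ for $0<k<1$. The area function (area of the egg-shaped part of a Hügelschäffer curve as a function of $k$, with $a,b,q$ treated as constants) is $$\mathcal{A}(k)=\begin{cases} a\,b\,q\,\pi, & k=0,\\ \frac{4}{3}\,a\,b\,q\,\bigl(K(k)+E(k)-D(k)\bigr), & k\in(0,1),\\ \frac{8}{3}\,a\,b\,q, & k=1.\end{cases}$$ The first Taylor approximation is $$T_n(k)=a\,b\,q\,\pi-a\,b\,q\,\pi\sum_{i=1}^{[n/2]}\frac{1}{(2i-1)(i+1)}\left(\frac{(2i-1)!!}{(2i)!!}\right)^2k^{2i}.$$ For fixed $\beta\in(0,1]$, the second Taylor approximation in the right neighborhood of $0$ is $$\mathbb{T}_n^{\beta}(k)=\begin{cases}T_{n-1}(k)+\dfrac{k^n}{\beta^n}\bigl(\mathcal{A}(\beta)-T_{n-1}(\beta)\bigr), & n\ge1,\\ \mathcal{A}(\beta), & n=0,\end{cases}\qquad k\in(0,\beta].$$ *)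

(* Defs.v *)
From Stdlib Require Import Reals Arith.
From Coquelicot Require Import Coquelicot.
Open Scope R_scope.

Fixpoint double_fact (n : nat) : nat :=
  match n with
  | O => 1
  | S O => 1
  | S (S m) => n * double_fact m
  end.

(* The elliptic integrals take the modulus [k], not the parameter [k ^ 2].
   They carry their intended meaning on [0, 1), [0, 1] and (0, 1) respectively;
   elsewhere their values are irrelevant. *)
Definition ellK (k : R) : R :=
  RInt (fun theta => 1 / sqrt (1 - k ^ 2 * sin theta ^ 2)) 0 (PI / 2).

Definition ellE (k : R) : R :=
  RInt (fun theta => sqrt (1 - k ^ 2 * sin theta ^ 2)) 0 (PI / 2).

Definition ellD (k : R) : R := (ellK k - ellE k) / k ^ 2.

(* Area of the egg-shaped part of a Huegelschaeffer curve, meaningful for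
   [k] in [0, 1] only. *)
Definition area (a b q k : R) : R :=
  if Req_EM_T k 0 then a * b * q * PI
  else if Req_EM_T k 1 then 8 / 3 * a * b * q
  else 4 / 3 * a * b * q * (ellK k + ellE k - ellD k).

(* [sum_n_m f 1 m] is 0 when [m = 0], so the first two approximations are
   constant. *)
Definition taylor1 (a b q : R) (n : nat) (k : R) : R :=
  a * b * q * PI
  - a * b * q * PI *
    sum_n_m (fun i : nat =>
      1 / ((2 * INR i - 1) * (INR i + 1))
      * (INR (double_fact (2 * i - 1)) / INR (double_fact (2 * i))) ^ 2
      * k ^ (2 * i)) 1 (n / 2).

(* Meaningful for [beta] in (0, 1] and [k] in (0, beta]. *)
Definition taylor2 (a b q beta : R) (n : nat) (k : R) : R :=
  match n with
  | O => area a b q beta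
  | S m => taylor1 a b q m k
           + k ^ n / beta ^ n * (area a b q beta - taylor1 a b q m beta)
  end.

(* Main.v *)
Require Import Defs.
From Stdlib Require Import Reals Arith Lra Lia.
From Coquelicot Require Import Coquelicot.
Open Scope R_scope.

(** Integrating the binomial series of [1 / sqrt (1 - k ^ 2 * sin t ^ 2)]
    against powers of [sin t] and using Wallis' integrals, one gets
    [area k = - C * sum_(i >= 0) c_i * k ^ (2 * i)] with [C = a * b * q * PI],
    [c_0 = -1] and [c_i > 0] for [i > 0].
    The partial sums [T_n] therefore decrease to the area.
    With the remainder written as [area - T_n = - C * r_n], where every term of
    [r_n] has degree at least [n + 1], the second approximation of order [n + 1]
    is [T_n k - C * (k / beta) ^ (n + 1) * r_n beta]; it lies below the area
    because [r_n k <= (k / beta) ^ (n + 1) * r_n beta] holds term by term. *)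

(** * Wallis ratios *)

(** The coefficient of [x ^ i] in the binomial series of [1 / sqrt (1 - x)]. At [i = 0] the
    truncated subtraction yields [double_fact 0], so the value is 1 as it should be. *)
Definition wallis (i : nat) : R :=
  INR (double_fact (2 * i - 1)) / INR (double_fact (2 * i)).

Lemma double_fact_pos (n : nat) : 0 < INR (double_fact n).
Proof.
apply lt_0_INR.
(* The recursion descends by two, so the induction carries two consecutive values. *)
assert (H : (0 < double_fact n /\ 0 < double_fact (S n))%nat); [|tauto].
induction n as [|n [IH1 IH2]]; [simpl; lia|].
split; [exact IH2|].
change (double_fact (S (S n))) with (S (S n) * double_fact n)%nat; nia.
Qed.

Lemma wallis_0 : wallis 0 = 1.
Proof. unfold wallis; simpl; lra. Qed.

Lemma wallis_S (i : nat) :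
  wallis (S i) = wallis i * ((2 * INR i + 1) / (2 * INR i + 2)).
Proof.
unfold wallis.
assert (Hi := pos_INR i).
assert (Hodd : INR (double_fact (2 * S i - 1))
               = (2 * INR i + 1) * INR (double_fact (2 * i - 1))).
(* The case [i = 0] is separate because [2 * i - 1] is truncated there. *)
{ destruct i as [|i]; [simpl; lra|].
  replace (2 * S (S i) - 1)%nat with (S (S (2 * S i - 1))) by lia.
  change (double_fact (S (S (2 * S i - 1))))
    with (S (S (2 * S i - 1)) * double_fact (2 * S i - 1))%nat.
  rewrite mult_INR; f_equal.
  replace (S (S (2 * S i - 1))) with (2 * S i + 1)%nat by lia.
  rewrite plus_INR, mult_INR; simpl; ring. }
assert (Heven : INR (double_fact (2 * S i))
                = (2 * INR i + 2) * INR (double_fact (2 * i))).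
{ replace (2 * S i)%nat with (S (S (2 * i))) by lia.
  change (double_fact (S (S (2 * i))))
    with (S (S (2 * i)) * double_fact (2 * i))%nat.
  rewrite mult_INR; f_equal.
  rewrite !S_INR, mult_INR; simpl; ring. }
rewrite Hodd, Heven; field.
split; [lra | apply Rgt_not_eq, double_fact_pos].
Qed.

Lemma wallis_bounds (i : nat) : 0 < wallis i <= 1.
Proof.
induction i as [|i IH]; [rewrite wallis_0; lra|].
rewrite wallis_S.
assert (Hi := pos_INR i).
assert (H : 0 < (2 * INR i + 1) / (2 * INR i + 2) <= 1).
{ split; [apply Rdiv_lt_0_compat; lra|].
  apply Rle_div_l; lra. }
split; [apply Rmult_lt_0_compat; lra|].
replace 1 with (1 * 1) by ring; apply Rmult_le_compat; lra.
Qed.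

(** * Partial sums of the binomial series and their remainder *)

Definition invsqrt_sum (N : nat) (x : R) : R :=
  sum_n (fun i => wallis i * x ^ i) N.

(* As [2 * (i + 1) * wallis (S i) = (2 * i + 1) * wallis i], the derivative telescopes
   to its last term, which makes the remainder estimate elementary. *)
Lemma is_derive_sqrt_mul_invsqrt_sum (N : nat) (x : R) : x < 1 ->
  is_derive (fun y => sqrt (1 - y) * invsqrt_sum N y) x
    (- ((2 * INR N + 1) * wallis N * x ^ N / (2 * sqrt (1 - x)))).
Proof.
intros Hx.
assert (Hs : 0 < sqrt (1 - x)) by (apply sqrt_lt_R0; lra).
assert (Hss : sqrt (1 - x) * sqrt (1 - x) = 1 - x) by (apply sqrt_sqrt; lra).
unfold invsqrt_sum; induction N as [|N IH].
- apply (is_derive_ext (fun y => sqrt (1 - y))).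
  { intros y; rewrite sum_O, wallis_0; simpl; ring. }
  auto_derive; [lra|].
  unfold Rminus in *; rewrite wallis_0; simpl; field; lra.
- apply (is_derive_ext (fun y =>
    sqrt (1 - y) * sum_n (fun i => wallis i * y ^ i) N
    + sqrt (1 - y) * (wallis (S N) * y ^ S N))).
  { intros y; rewrite sum_Sn; unfold plus; cbn -[sum_n pow]; ring. }
  assert (Hlast : is_derive (fun y => sqrt (1 - y) * (wallis (S N) * y ^ S N)) x
     (- / (2 * sqrt (1 - x)) * (wallis (S N) * x ^ S N)
      + sqrt (1 - x) * (wallis (S N) * (INR (S N) * x ^ N)))).
  { auto_derive; [lra|].
    replace (1 + -x) with (1 - x) by ring.
    rewrite S_INR. simpl pow. simpl pred. destruct N; simpl INR; field; lra. }
  assert (H := is_derive_plus _ _ _ _ _ IH Hlast).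
  replace (- ((2 * INR (S N) + 1) * wallis (S N) * x ^ S N / (2 * sqrt (1 - x))))
    with (- ((2 * INR N + 1) * wallis N * x ^ N / (2 * sqrt (1 - x)))
     + (- / (2 * sqrt (1 - x)) * (wallis (S N) * x ^ S N)
      + sqrt (1 - x) * (wallis (S N) * (INR (S N) * x ^ N)))); [exact H|].
  assert (HN := pos_INR N).
  (* With a single Wallis ratio left, and [x] replaced by [1 - s * s] below, the identity becomes
     rational in [s = sqrt (1 - x)] and [p = x ^ N]. *)
  replace (wallis N) with (wallis (S N) * ((2 * INR N + 2) / (2 * INR N + 1)))
    by (rewrite wallis_S; field; lra).
  rewrite S_INR; simpl pow.
  clear IH Hlast H Hx.
  generalize dependent (x ^ N); generalize dependent (sqrt (1 - x)).
  intros s Hs Hss p.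
  replace x with (1 - s * s) by lra.
  field; lra.
Qed.

(** The function [sqrt (1 - y) * invsqrt_sum N y] is 1 at 0, so the mean value theorem on [[0, x]]
    gives [1 / sqrt (1 - x) = invsqrt_sum N x + d * x / sqrt (1 - x)], where [- d <= 0] is its
    derivative at some [xi]. The bound on the last term is uniform in [x], which allows
    integration. *)
Lemma invsqrt_sum_approx (N : nat) (q x : R) : q < 1 -> 0 <= x <= q ->
  invsqrt_sum N x <= / sqrt (1 - x)
    <= invsqrt_sum N x + (2 * INR N + 1) * q ^ N / (2 * (1 - q)).
Proof.
intros Hq Hx.
assert (HN := pos_INR N).
assert (Hs : 0 < sqrt (1 - x)) by (apply sqrt_lt_R0; lra).
assert (Hss : sqrt (1 - x) * sqrt (1 - x) = 1 - x) by (apply sqrt_sqrt; lra).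
destruct (MVT_gen (fun y => sqrt (1 - y) * invsqrt_sum N y) 0 x
  (fun x => - ((2 * INR N + 1) * wallis N * x ^ N / (2 * sqrt (1 - x)))))
  as [xi [Hxi Heq]].
{ rewrite Rmin_left, Rmax_right by lra; intros y Hy.
  apply is_derive_sqrt_mul_invsqrt_sum; lra. }
{ rewrite Rmin_left, Rmax_right by lra; intros y Hy.
  apply continuity_pt_filterlim.
  apply (ex_derive_continuous (fun y => sqrt (1 - y) * invsqrt_sum N y)).
  eexists; apply is_derive_sqrt_mul_invsqrt_sum; lra. }
rewrite Rmin_left, Rmax_right in Hxi by lra.
assert (H0 : invsqrt_sum N 0 = 1).
{ unfold invsqrt_sum; clear; induction N as [|N IH].
  - rewrite sum_O, wallis_0; simpl; ring.
  - rewrite sum_Sn, IH; unfold plus; simpl; ring. }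
rewrite H0, Rminus_0_r, sqrt_1, Rminus_0_r in Heq.
assert (Hsx : sqrt (1 - x) <= sqrt (1 - xi)) by (apply sqrt_le_1; lra).
assert (Hw := wallis_bounds N).
assert (Hp : 0 <= xi ^ N <= q ^ N)
  by (split; [apply pow_le; lra | apply pow_incr; lra]).
set (P := invsqrt_sum N x) in *.
set (s := sqrt (1 - x)) in *.
set (t := sqrt (1 - xi)) in *.
set (M := (2 * INR N + 1) * q ^ N).
assert (Hnum : 0 <= (2 * INR N + 1) * wallis N * xi ^ N <= M).
{ assert (0 <= wallis N * xi ^ N <= q ^ N) by nra.
  unfold M; rewrite Rmult_assoc; split; [nra|].
  apply Rmult_le_compat_l; lra. }
assert (Hinv : 0 < / (2 * t) <= / (2 * s)).
{ split; [apply Rinv_0_lt_compat; lra | apply Rinv_le_contravar; lra]. }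
assert (Hd : 0 <= (2 * INR N + 1) * wallis N * xi ^ N / (2 * t) <= M / (2 * s)).
{ unfold Rdiv; split; [nra|]. apply Rmult_le_compat; lra. }
set (d := (2 * INR N + 1) * wallis N * xi ^ N / (2 * t)) in *.
assert (E : / s = P + d * x / s).
{ apply (Rmult_eq_reg_r s); [|lra]. field_simplify; lra. }
assert (His : 0 < / s) by (apply Rinv_0_lt_compat; lra).
rewrite E; split.
{ assert (0 <= d * x / s); [|lra].
  apply Rmult_le_pos; [apply Rmult_le_pos|]; lra. }
apply Rplus_le_compat_l.
apply Rle_trans with (M / (2 * s) * 1 / s).
{ apply Rmult_le_compat_r; [lra|]. apply Rmult_le_compat; lra. }
(* Here [s * s = 1 - x >= 1 - q]. *)
replace (M / (2 * s) * 1 / s) with (M * / (2 * (s * s))) by (field; lra).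
apply Rmult_le_compat_l; [lra|].
apply Rinv_le_contravar; lra.
Qed.

(** Up to the factor [c], this is the general term of a series that converges by the ratio test,
    with ratios [q + 2 * q / (2 * N + 1)]. The case [q = 0] is split off because the test needs
    nonzero terms. *)
Lemma is_lim_seq_linear_geom (q c : R) : 0 <= q < 1 ->
  is_lim_seq (fun N => (2 * INR N + 1) * q ^ N * c) 0.
Proof.
intros Hq.
replace 0 with (0 * c) by ring.
apply is_lim_seq_scal_r with (lu := Finite 0).
destruct (Req_dec q 0) as [->|Hq0].
{ apply is_lim_seq_incr_1.
  apply is_lim_seq_ext with (fun _ => 0); [intros n; simpl; ring|].
  apply is_lim_seq_const. }
apply ex_series_lim_0.
apply ex_series_ext with (fun N => Rabs ((2 * INR N + 1) * q ^ N)).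
{ intros N; apply Rabs_pos_eq, Rmult_le_pos;
    [assert (H := pos_INR N); lra | apply pow_le; lra]. }
apply ex_series_DAlembert with q; [lra| |].
{ intros N; apply Rmult_integral_contrapositive; split;
    [assert (H := pos_INR N); lra | apply pow_nonzero; lra]. }
apply is_lim_seq_ext with (fun N => q + 2 * q * / (2 * INR N + 1)).
{ intros N; assert (H := pos_INR N).
  rewrite S_INR; simpl pow.
  replace ((2 * (INR N + 1) + 1) * (q * q ^ N) / ((2 * INR N + 1) * q ^ N))
    with (q + 2 * q * / (2 * INR N + 1)).
  2: { field; split; [apply pow_nonzero; lra | lra]. }
  symmetry; apply Rabs_pos_eq.
  assert (0 < / (2 * INR N + 1)) by (apply Rinv_0_lt_compat; lra). nra. }
replace (Finite q) with (Finite (q + 2 * q * 0)) by (f_equal; ring).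
apply is_lim_seq_plus'; [apply is_lim_seq_const|].
apply is_lim_seq_scal_l with (lu := Finite 0).
replace (Finite 0) with (Rbar_inv p_infty) by reflexivity.
apply is_lim_seq_inv; [|discriminate].
apply is_lim_seq_le_p_loc with INR; [|apply is_lim_seq_INR].
exists 0%nat; intros n _; assert (H := pos_INR n); lra.
Qed.

(** * Wallis integrals and termwise integration *)

(** The reduction formula comes from integrating the derivative of [- cos t * sin t ^ (2 * m + 1)],
    which vanishes at both endpoints. *)
Lemma is_RInt_sin_pow_even (m : nat) :
  is_RInt (fun t => sin t ^ (2 * m)) 0 (PI / 2) (PI / 2 * wallis m).
Proof.
induction m as [|m IH].
{ rewrite wallis_0; simpl.
  replace (PI / 2 * 1) with (scal (PI / 2 - 0) 1)
    by (unfold scal; simpl; unfold mult; simpl; ring).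
  apply (is_RInt_const (V := R_NormedModule)). }
assert (Hm := pos_INR m).
assert (HF : is_RInt (fun t => (2 * INR m + 2) * sin t ^ (2 * S m)
                               - (2 * INR m + 1) * sin t ^ (2 * m)) 0 (PI / 2)
  (- cos (PI / 2) * sin (PI / 2) ^ (2 * m + 1) - - cos 0 * sin 0 ^ (2 * m + 1))).
{ apply (is_RInt_derive (fun t => - cos t * sin t ^ (2 * m + 1))).
  - intros t _; auto_derive; [trivial|].
    replace (m + (m + 0) + 1)%nat with (S (2 * m)) by lia.
    replace (2 * S m)%nat with (S (S (2 * m))) by lia.
    rewrite S_INR, mult_INR, Nat.pred_succ.
    rewrite <- !tech_pow_Rmult.
    replace (INR 2) with 2 by reflexivity.
    generalize (sin t ^ (2 * m)); intros p.
    transitivity (p * (sin t * sin t) + (2 * INR m + 1) * p * - (cos t * cos t)); [ring|].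
    assert (H := sin2_cos2 t); unfold Rsqr in H.
    replace (cos t * cos t) with (1 - sin t * sin t) by lra; ring.
  - intros t _.
    apply (ex_derive_continuous (V := R_NormedModule)); auto_derive; trivial. }
rewrite cos_PI2, sin_0, (pow_ne_zero (2 * m + 1)) in HF by lia.
replace (PI / 2 * wallis (S m)) with
  (/ (2 * INR m + 2) * (- 0 * sin (PI / 2) ^ (2 * m + 1) - - cos 0 * 0)
   + (2 * INR m + 1) / (2 * INR m + 2) * (PI / 2 * wallis m))
  by (rewrite wallis_S; field; lra).
apply (is_RInt_ext (fun t =>
   / (2 * INR m + 2) * ((2 * INR m + 2) * sin t ^ (2 * S m)
                               - (2 * INR m + 1) * sin t ^ (2 * m))
   + (2 * INR m + 1) / (2 * INR m + 2) * sin t ^ (2 * m))).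
{ intros t _.
  match goal with |- @eq _ ?l ?r => change (@eq R l r) end; field; lra. }
apply (is_RInt_plus (V := R_NormedModule));
  apply (is_RInt_scal (V := R_NormedModule)); assumption.
Qed.

(** The weight [sin t ^ (2 * m)] shifts the index of the Wallis integral of each term by [m]. The
    weight with [m = 0] serves [K], the one with [m = 1] serves [D]. *)
Lemma is_RInt_invsqrt_sum (k : R) (m N : nat) :
  is_RInt (fun t => sin t ^ (2 * m) * invsqrt_sum N (k ^ 2 * sin t ^ 2))
    0 (PI / 2)
    (sum_n (fun i => PI / 2 * (wallis i * wallis (i + m)) * k ^ (2 * i)) N).
Proof.
assert (Hterm : forall i,
  is_RInt (fun t => sin t ^ (2 * m) * (wallis i * (k ^ 2 * sin t ^ 2) ^ i))
    0 (PI / 2) (PI / 2 * (wallis i * wallis (i + m)) * k ^ (2 * i))).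
{ intros i.
  replace (PI / 2 * (wallis i * wallis (i + m)) * k ^ (2 * i))
    with (wallis i * k ^ (2 * i) * (PI / 2 * wallis (i + m))) by ring.
  apply (is_RInt_ext (fun t => wallis i * k ^ (2 * i) * sin t ^ (2 * (i + m)))).
  { intros t _.
    rewrite Rpow_mult_distr, <- !pow_mult, Nat.mul_add_distr_l, pow_add.
    match goal with |- @eq _ ?l ?r => change (@eq R l r) end; ring. }
  apply (is_RInt_scal (V := R_NormedModule)), is_RInt_sin_pow_even. }
unfold invsqrt_sum; induction N as [|N IH].
- rewrite sum_O.
  apply (is_RInt_ext (fun t => sin t ^ (2 * m)
                               * (wallis 0 * (k ^ 2 * sin t ^ 2) ^ 0))).
  { intros t _; rewrite sum_O; reflexivity. }
  apply Hterm.
- rewrite sum_Sn.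
  apply (is_RInt_ext (fun t =>
    plus (sin t ^ (2 * m) * sum_n (fun i => wallis i * (k ^ 2 * sin t ^ 2) ^ i) N)
         (sin t ^ (2 * m) * (wallis (S N) * (k ^ 2 * sin t ^ 2) ^ S N)))).
  { intros t _; rewrite sum_Sn; symmetry; apply Rmult_plus_distr_l. }
  apply (is_RInt_plus (V := R_NormedModule)); [exact IH | apply Hterm].
Qed.

Lemma modulus_sin_bounds (k t : R) : 0 <= k < 1 ->
  k ^ 2 < 1 /\ 0 <= k ^ 2 * sin t ^ 2 <= k ^ 2.
Proof.
intros Hk.
assert (Hs := sin2_cos2 t); unfold Rsqr in Hs.
assert (0 <= sin t ^ 2 <= 1) by (simpl; nra).
assert (0 <= k ^ 2) by nra.
split; nra.
Qed.

Lemma continuous_sin_pow_invsqrt (k t : R) (m : nat) : 0 <= k < 1 ->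
  continuous (fun t => sin t ^ m * / sqrt (1 - k ^ 2 * sin t ^ 2)) t.
Proof.
intros Hk.
destruct (modulus_sin_bounds k t Hk) as [H1 H2].
apply (ex_derive_continuous (V := R_NormedModule)).
simpl in H1, H2.
auto_derive; split; [lra|split; [|trivial]].
apply Rgt_not_eq, sqrt_lt_R0; lra.
Qed.

(** Squeeze: since the weight is at most 1, integrating the remainder estimate over an interval of
    length [PI / 2] puts the partial sums between [I - PI / 2 * err N] and [I], and [err] tends to
    0. *)
Lemma is_series_RInt_invsqrt (k : R) (m : nat) : 0 <= k < 1 ->
  is_series (fun i => PI / 2 * (wallis i * wallis (i + m)) * k ^ (2 * i))
    (RInt (fun t => sin t ^ (2 * m) * / sqrt (1 - k ^ 2 * sin t ^ 2)) 0 (PI / 2)).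
Proof.
intros Hk.
assert (HPI := PI_RGT_0).
set (I := RInt _ _ _).
assert (HI : is_RInt (fun t => sin t ^ (2 * m) * / sqrt (1 - k ^ 2 * sin t ^ 2))
               0 (PI / 2) I).
{ apply (RInt_correct (V := R_CompleteNormedModule)).
  apply (ex_RInt_continuous (V := R_CompleteNormedModule)); intros t _.
  apply continuous_sin_pow_invsqrt, Hk. }
set (err := fun N => (2 * INR N + 1) * (k ^ 2) ^ N / (2 * (1 - k ^ 2))).
assert (Hbd : forall N,
  let s := sum_n (fun i => PI / 2 * (wallis i * wallis (i + m)) * k ^ (2 * i)) N in
  I - PI / 2 * err N <= s <= I).
{ intros N s.
  assert (Hpw : forall t, let x := k ^ 2 * sin t ^ 2 in let g := sin t ^ (2 * m) in
    g * invsqrt_sum N x <= g * / sqrt (1 - x) <= g * invsqrt_sum N x + err N).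
  { intros t x g.
    destruct (modulus_sin_bounds k t Hk) as [H1 H2].
    destruct (invsqrt_sum_approx N (k ^ 2) x H1 H2) as [H3 H4].
    assert (Hg : 0 <= g <= 1).
    { unfold g; rewrite pow_mult.
      assert (Hs := sin2_cos2 t); unfold Rsqr in Hs.
      assert (Hs2 : 0 <= sin t ^ 2 <= 1) by (simpl; nra).
      split; [apply pow_le; lra|].
      rewrite <- (pow1 m); apply pow_incr, Hs2. }
    fold (err N) in H4.
    split; [apply Rmult_le_compat_l; lra|].
    assert (0 <= err N) by lra.
    nra. }
  assert (Hs := is_RInt_invsqrt_sum k m N); fold s in Hs.
  split.
  - assert (Hc : is_RInt (fun _ => err N) 0 (PI / 2) ((PI / 2 - 0) * err N))
      by apply (is_RInt_const (V := R_NormedModule)).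
    assert (Hp := is_RInt_plus (V := R_NormedModule) _ _ _ _ _ _ Hs Hc).
    assert (H := is_RInt_le _ _ 0 (PI / 2) _ _ ltac:(lra) HI Hp
                  (fun t _ => proj2 (Hpw t))).
    unfold plus in H; simpl in H; lra.
  - apply (is_RInt_le _ _ 0 (PI / 2) _ _ ltac:(lra) Hs HI
            (fun t _ => proj1 (Hpw t))). }
destruct (modulus_sin_bounds k 0 Hk) as [Hk2 _].
apply (is_lim_seq_le_le (fun N => I - PI / 2 * err N) _ (fun _ => I) I).
- exact Hbd.
- replace (Finite I) with (Finite (I - PI / 2 * 0)) by (f_equal; ring).
  apply is_lim_seq_minus'; [apply is_lim_seq_const|].
  apply is_lim_seq_scal_l with (lu := Finite 0).
  apply is_lim_seq_linear_geom; nra.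
- apply is_lim_seq_const.
Qed.

(** * The area as a power series in the modulus *)

(* The coefficient of [k ^ (2 * i)] in [4 / 3 * (K + E - D)] is [- PI * area_coef i]; in particular
   [area_coef 0 = -1] absorbs the constant term. *)
Definition area_coef (i : nat) : R :=
  1 / ((2 * INR i - 1) * (INR i + 1)) * wallis i ^ 2.

Lemma area_coef_0 : area_coef 0 = -1.
Proof. unfold area_coef; rewrite wallis_0; simpl; field. Qed.

Lemma area_coef_pos (i : nat) : (0 < i)%nat -> 0 < area_coef i.
Proof.
intros Hi; apply le_INR in Hi; simpl in Hi.
assert (Hw := wallis_bounds i).
apply Rmult_lt_0_compat; [|nra].
apply Rdiv_lt_0_compat; [lra|].
apply Rmult_lt_0_compat; lra.
Qed.

(** Pointwise, [sqrt u = 1 / sqrt u - (1 - u) / sqrt u] with [u = 1 - k ^ 2 * sin t ^ 2]. For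
    [k > 0] the integral on the right is therefore [ellD k]. *)
Lemma ellE_eq_ellK_minus (k : R) : 0 <= k < 1 ->
  ellE k = ellK k
    - k ^ 2 * RInt (fun t => sin t ^ 2 * / sqrt (1 - k ^ 2 * sin t ^ 2)) 0 (PI / 2).
Proof.
intros Hk.
assert (Hex : forall m,
  ex_RInt (fun t => sin t ^ m * / sqrt (1 - k ^ 2 * sin t ^ 2)) 0 (PI / 2)).
{ intros m; apply (ex_RInt_continuous (V := R_CompleteNormedModule)); intros t _.
  apply continuous_sin_pow_invsqrt, Hk. }
unfold ellE, ellK.
apply is_RInt_unique.
apply (is_RInt_ext (fun t =>
   1 / sqrt (1 - k ^ 2 * sin t ^ 2)
   - k ^ 2 * (sin t ^ 2 * / sqrt (1 - k ^ 2 * sin t ^ 2)))).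
{ intros t _.
  destruct (modulus_sin_bounds k t Hk) as [H1 H2].
  assert (Hs : 0 < sqrt (1 - k ^ 2 * sin t ^ 2)) by (apply sqrt_lt_R0; lra).
  assert (Hss := sqrt_sqrt (1 - k ^ 2 * sin t ^ 2) ltac:(lra)).
  apply (Rmult_eq_reg_r (sqrt (1 - k ^ 2 * sin t ^ 2))); [|lra].
  rewrite Hss. set (s := sqrt _) in *. field. lra. }
apply (is_RInt_minus (V := R_NormedModule)).
- apply (RInt_correct (V := R_CompleteNormedModule)).
  apply (ex_RInt_ext (fun t => sin t ^ 0 * / sqrt (1 - k ^ 2 * sin t ^ 2)));
    [|apply Hex].
  intros t _; simpl (sin t ^ 0); unfold Rdiv; reflexivity.
- apply (is_RInt_scal (V := R_NormedModule)).
  apply (RInt_correct (V := R_CompleteNormedModule)), Hex.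
Qed.

(** As [E = K - k ^ 2 * D], the combination [K + E - D] equals [2 * K - D - k ^ 2 * D], and the
    series of [K] and [D] are known. *)
Lemma is_series_area (a b q k : R) : 0 < k < 1 ->
  is_series (fun i => - (a * b * q * PI) * (area_coef i * k ^ (2 * i)))
    (area a b q k).
Proof.
intros Hk.
assert (Hk' : 0 <= k < 1) by lra.
unfold area.
destruct (Req_EM_T k 0) as [?|_]; [lra|].
destruct (Req_EM_T k 1) as [?|_]; [lra|].
unfold ellD; rewrite ellE_eq_ellK_minus by exact Hk'.
assert (HD := is_series_RInt_invsqrt k 1 Hk').
assert (HK := is_series_RInt_invsqrt k 0 Hk').
change (2 * 1)%nat with 2%nat in HD.
set (D := RInt _ _ _) in HD |- *.
replace (RInt _ _ _) with (ellK k) in HK.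
2: { apply RInt_ext; intros t _; simpl (sin t ^ (2 * 0)); unfold Rdiv; reflexivity. }
set (K := ellK k) in *.
(* The series of [k ^ 2 * D] is that of [D] moved up by one index, with 0 in front. *)
set (dshift := fun i => match i with
   | O => 0
   | S j => k ^ 2 * (PI / 2 * (wallis j * wallis (j + 1)) * k ^ (2 * j)) end).
assert (HkD : is_series dshift (k ^ 2 * D)).
{ apply is_series_decr_1.
  unfold plus, opp; simpl (dshift 0%nat); simpl.
  replace (k * (k * 1) * D + - 0) with (k ^ 2 * D) by (simpl; ring).
  apply (is_series_scal (k ^ 2) _ D HD). }
assert (H := is_series_scal (4 / 3 * a * b * q) _ _
  (is_series_minus _ _ _ _ (is_series_minus _ _ _ _
     (is_series_scal 2 _ _ HK) HD) HkD)).
replace (4 / 3 * a * b * q * (K + (K - k ^ 2 * D) - (K - (K - k ^ 2 * D)) / k ^ 2))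
  with (4 / 3 * a * b * q * (2 * K - D - k ^ 2 * D)) by (field; lra).
revert H; apply is_series_ext; intros i.
change (4 / 3 * a * b * q *
  (2 * (PI / 2 * (wallis i * wallis (i + 0)) * k ^ (2 * i))
   - PI / 2 * (wallis i * wallis (i + 1)) * k ^ (2 * i) - dshift i)
  = - (a * b * q * PI) * (area_coef i * k ^ (2 * i))).
rewrite Nat.add_0_r, Nat.add_1_r.
unfold area_coef, dshift; destruct i as [|j].
- rewrite (wallis_S 0), wallis_0; simpl; field.
- assert (Hj := pos_INR j).
  (* Three consecutive Wallis ratios occur; all are expressed through [wallis (S j)]. *)
  rewrite Nat.add_1_r, (wallis_S (S j)).
  replace (wallis j) with (wallis (S j) * ((2 * INR j + 2) / (2 * INR j + 1)))
    by (rewrite wallis_S; field; lra).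
  replace (2 * S j)%nat with (2 + 2 * j)%nat by lia.
  rewrite pow_add, S_INR; field; lra.
Qed.

(** Since [area_coef 0 = -1], the leading constant is the term of index 0, and the approximation is
    a genuine partial sum of the area series. *)
Lemma taylor1_sum (a b q : R) (n : nat) (k : R) :
  taylor1 a b q n k
  = sum_n (fun i => - (a * b * q * PI) * (area_coef i * k ^ (2 * i))) (n / 2).
Proof.
unfold taylor1.
generalize (n / 2)%nat; intros m.
assert (H : sum_n (fun i => - (a * b * q * PI) * (area_coef i * k ^ (2 * i))) m
  = - (a * b * q * PI) * sum_n (fun i => area_coef i * k ^ (2 * i)) m)
  by apply (sum_n_mult_l (K := R_Ring)).
rewrite H.
unfold sum_n at 1.
rewrite (sum_Sn_m (G := R_AbelianMonoid) _ 0) by lia.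
rewrite area_coef_0.
set (s := sum_n_m _ 1 m).
change (a * b * q * PI - a * b * q * PI * s
        = - (a * b * q * PI) * (-1 * 1 + s)).
ring.
Qed.

(** * Tails of the area series *)

(** The remainder of orders [2 * m] and [2 * m + 1], divided by [- a * b * q * PI] so that all its
    coefficients are positive. *)
Definition area_tail (m : nat) (k : R) : R :=
  Series (fun i => area_coef (S m + i) * k ^ (2 * (S m + i))).

Lemma ex_series_area_tail (m : nat) (k : R) : 0 < k < 1 ->
  ex_series (fun i => area_coef (S m + i) * k ^ (2 * (S m + i))).
Proof.
intros Hk.
apply (ex_series_incr_n (fun i => area_coef i * k ^ (2 * i))).
(* Convergence is read off from the area series with [a = b = q = 1]. *)
exists (/ - (1 * 1 * 1 * PI) * area 1 1 1 k).
assert (H := is_series_scal (/ - (1 * 1 * 1 * PI)) _ _ (is_series_area 1 1 1 k Hk)).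
revert H; apply is_series_ext; intros i.
assert (HPI := PI_RGT_0).
unfold scal; simpl; unfold mult; cbn -[Nat.mul pow]; field; lra.
Qed.

Lemma area_taylor1 (a b q : R) (n : nat) (k : R) : 0 < k < 1 ->
  area a b q k
  = taylor1 a b q n k - a * b * q * PI * area_tail (n / 2) k.
Proof.
intros Hk.
rewrite taylor1_sum; generalize (n / 2)%nat; intros m.
assert (H := is_series_area a b q k Hk).
rewrite <- (is_series_unique _ _ H).
rewrite (Series_incr_n _ (S m)); [|lia|eexists; exact H].
rewrite sum_n_Reals, Nat.pred_succ.
unfold area_tail; rewrite Series_scal_l; ring.
Qed.

Lemma area_tail_nonneg (m : nat) (k : R) : 0 < k < 1 -> 0 <= area_tail m k.
Proof.
intros Hk.
(* Zero is written as a series so that the comparison can be made termwise. *)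
rewrite <- (Rmult_0_l (Series (fun _ => 0))), <- Series_scal_l.
apply Series_le; [|apply ex_series_area_tail, Hk].
intros i; assert (Hc := area_coef_pos (S m + i) ltac:(lia)).
assert (Hp := pow_lt k (2 * (S m + i)) ltac:(lra)).
nra.
Qed.

(** Every exponent [e] in the tail is at least [n], so [k ^ e] is [(k / beta) ^ n * beta ^ e] times
    [(k / beta) ^ (e - n)], a factor at most 1. *)
Lemma area_tail_scale (m n : nat) (k beta : R) : 0 < k <= beta -> beta < 1 ->
  (n <= 2 * S m)%nat ->
  area_tail m k <= (k / beta) ^ n * area_tail m beta.
Proof.
intros Hk Hb Hn.
assert (Hx : 0 < k / beta <= 1).
{ split; [apply Rdiv_lt_0_compat; lra|]. apply Rle_div_l; lra. }
unfold area_tail; rewrite <- Series_scal_l.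
apply Series_le.
- intros i; assert (Hc := area_coef_pos (S m + i) ltac:(lia)).
  set (e := (2 * (S m + i))%nat).
  assert (Hp := pow_lt k e ltac:(lra)).
  split; [nra|].
  replace (k ^ e) with ((k / beta) ^ n * (k / beta) ^ (e - n) * beta ^ e).
  2: { rewrite <- pow_add.
       replace (n + (e - n))%nat with e by (unfold e; lia).
       rewrite <- Rpow_mult_distr; f_equal; field; lra. }
  assert (Hp1 := pow_lt (k / beta) n ltac:(lra)).
  assert (Hp2 := pow_lt beta e ltac:(lra)).
  assert (Hp3 : (k / beta) ^ (e - n) <= 1)
    by (rewrite <- (pow1 (e - n)); apply pow_incr; lra).
  set (u := (k / beta) ^ n) in *; set (v := (k / beta) ^ (e - n)) in *.
  replace (area_coef (S m + i) * (u * v * beta ^ e))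
    with (v * (u * (area_coef (S m + i) * beta ^ e))) by ring.
  rewrite <- (Rmult_1_l (u * _)) at 2.
  apply Rmult_le_compat_r; [|exact Hp3].
  apply Rmult_le_pos; [lra|]; apply Rmult_le_pos; lra.
- apply (ex_series_scal_l (V := R_NormedModule)), ex_series_area_tail; lra.
Qed.

(** * The second approximations and the two chains of inequalities *)

Lemma taylor2_S (a b q beta : R) (n : nat) (k : R) : 0 < beta < 1 ->
  taylor2 a b q beta (S n) k
  = taylor1 a b q n k
    - a * b * q * PI * ((k / beta) ^ S n * area_tail (n / 2) beta).
Proof.
intros Hb.
unfold taylor2.
rewrite (area_taylor1 a b q n beta Hb).
unfold Rdiv at 2; rewrite Rpow_mult_distr, pow_inv.
field; apply pow_nonzero; lra.
Qed.

(* Passing from order [S n] to order [S (S n)], [taylor1] changes by a term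
   [d * k ^ S n] that the tail at [beta] picks up as [d * beta ^ S n], so only
   the factor [1 - k / beta] survives. *)
Lemma taylor2_S_diff (a b q beta : R) (n : nat) (k : R) : 0 < beta < 1 ->
  taylor2 a b q beta (S (S n)) k - taylor2 a b q beta (S n) k
  = a * b * q * PI
    * ((k / beta) ^ S n * (1 - k / beta) * area_tail (S n / 2) beta).
Proof.
intros Hb.
assert (HT : exists d, forall x,
  taylor1 a b q (S n) x = taylor1 a b q n x + d * x ^ S n).
(* For even [n] both orders have the same half and [d = 0]; for odd [n] exactly one term is
   added. *)
{ destruct (Nat.Even_or_Odd n) as [[m ->]|[m ->]].
  - exists 0; intros x; unfold taylor1.
    replace (S (2 * m) / 2)%nat with m by (apply (Nat.div_unique _ _ _ 1); lia).
    replace (2 * m / 2)%nat with m by (apply (Nat.div_unique _ _ _ 0); lia).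
    ring.
  - exists (- (a * b * q * PI) * area_coef (S m)); intros x.
    rewrite !taylor1_sum.
    replace (S (2 * m + 1) / 2)%nat with (S m)
      by (apply (Nat.div_unique _ _ _ 0); lia).
    replace ((2 * m + 1) / 2)%nat with m by (apply (Nat.div_unique _ _ _ 1); lia).
    rewrite sum_Sn.
    replace (S (2 * m + 1)) with (2 * S m)%nat by lia.
    rewrite (Rmult_assoc _ (area_coef (S m))); reflexivity. }
destruct HT as [d HT].
(* Equating the expansions of the area at [beta] of orders [n] and [S n] relates the two tails
   through [d * beta ^ S n]. *)
assert (Hr := area_taylor1 a b q n beta Hb).
rewrite (area_taylor1 a b q (S n) beta Hb), HT in Hr.
rewrite !taylor2_S, HT by exact Hb.
replace (k ^ S n) with ((k / beta) ^ S n * beta ^ S n)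
  by (rewrite <- Rpow_mult_distr; f_equal; field; lra).
change ((k / beta) ^ S (S n)) with (k / beta * (k / beta) ^ S n).
replace (a * b * q * PI * ((k / beta) ^ S n * area_tail (n / 2) beta))
  with ((k / beta) ^ S n * (a * b * q * PI * area_tail (n / 2) beta)) by ring.
replace (a * b * q * PI * area_tail (n / 2) beta)
  with (a * b * q * PI * area_tail (S n / 2) beta - d * beta ^ S n) by lra.
ring.
Qed.

Theorem mainTheorem4 :
  forall a b q : R, 0 < a -> 0 < b -> 0 < q <= 1 ->
  forall beta : R, 0 < beta < 1 ->
  forall k : R, 0 < k <= beta ->
    a * b * q * PI = taylor1 a b q 0 k
    /\ (forall i j : nat,
          taylor1 a b q (2 * i) k = taylor1 a b q (2 * i + 1) k
          /\ taylor1 a b q (2 * i + 1) k >= taylor1 a b q (2 * i + 2) k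
          /\ taylor1 a b q (2 * i + 2) k >= area a b q k
          /\ area a b q k >= taylor2 a b q beta (j + 1) k
          /\ taylor2 a b q beta (j + 1) k >= taylor2 a b q beta j k)
    /\ taylor2 a b q beta 0 k = area a b q beta.
Proof.
intros a b q Ha Hb Hq beta Hbeta k Hk.
assert (HC : 0 < a * b * q * PI)
  by (assert (HPI := PI_RGT_0);
      apply Rmult_lt_0_compat; [do 2 (apply Rmult_lt_0_compat; [|lra])|]; lra).
assert (Hk1 : 0 < k < 1) by lra.
assert (Hx : 0 < k / beta <= 1).
{ split; [apply Rdiv_lt_0_compat; lra|]. apply Rle_div_l; lra. }
assert (HT0 : forall x, taylor1 a b q 0 x = a * b * q * PI).
{ intros x; rewrite taylor1_sum; simpl (0 / 2)%nat; rewrite sum_O, area_coef_0.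
  simpl; ring. }
split; [symmetry; apply HT0|]; split; [|reflexivity].
intros i j.
rewrite !taylor1_sum.
replace (2 * i / 2)%nat with i by (apply (Nat.div_unique _ _ _ 0); lia).
replace ((2 * i + 1) / 2)%nat with i by (apply (Nat.div_unique _ _ _ 1); lia).
rewrite Nat.add_1_r.
split; [reflexivity|]; split; [|split; [|split]].
- replace ((2 * i + 2) / 2)%nat with (S i)
    by (apply (Nat.div_unique _ _ _ 0); lia).
  rewrite sum_Sn; change plus with Rplus.
  assert (Hc := area_coef_pos (S i) ltac:(lia)).
  assert (Hp := pow_lt k (2 * S i) ltac:(lra)).
  assert (0 < a * b * q * PI * (area_coef (S i) * k ^ (2 * S i)))
    by (apply Rmult_lt_0_compat; [|apply Rmult_lt_0_compat]; lra).
  set (s := sum_n _ i); lra.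
- rewrite <- taylor1_sum, (area_taylor1 a b q (2 * i + 2) k Hk1).
  assert (H := area_tail_nonneg ((2 * i + 2) / 2) k Hk1).
  nra.
- rewrite taylor2_S, (area_taylor1 a b q j k Hk1) by exact Hbeta.
  (* Halving loses at most one, so the tail starts at degree [j + 1] or later. *)
  assert (Hn : (S j <= 2 * S (j / 2))%nat).
  { assert (H := Nat.div_mod_eq j 2).
    assert (H' := Nat.mod_upper_bound j 2 ltac:(lia)); lia. }
  assert (H := area_tail_scale (j / 2) (S j) k beta Hk (proj2 Hbeta) Hn).
  apply Rle_ge, Rplus_le_compat_l, Ropp_le_contravar, Rmult_le_compat_l; lra.
- assert (Ht := fun m => area_tail_nonneg m beta Hbeta).
  (* Order 0 is the constant [area a b q beta], defined apart from the others. As [taylor1] of order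
     0 is constant too, only [k / beta <= 1] is needed there. *)
  destruct j as [|n].
  + rewrite taylor2_S by exact Hbeta; unfold taylor2.
    rewrite (area_taylor1 a b q 0 beta Hbeta), !HT0, pow_1.
    assert (H0 := Ht (0 / 2)%nat).
    set (r := area_tail _ _) in *.
    apply Rle_ge, Rplus_le_compat_l, Ropp_le_contravar, Rmult_le_compat_l; nra.
  + assert (Hd := taylor2_S_diff a b q beta n k Hbeta).
    assert (0 <= a * b * q * PI
      * ((k / beta) ^ S n * (1 - k / beta) * area_tail (S n / 2) beta)); [|lra].
    apply Rmult_le_pos; [lra|]; apply Rmult_le_pos; [|apply Ht].
    apply Rmult_le_pos; [apply pow_le|]; lra.
Qed.
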